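(* Let $\mathbf L$ be an $\mathrm e$-cyclic residuated lattice. Then the poset $\mathcal C(\mathbf L)$ of convex subalgebras of $\mathbf L$, ordered by inclusion, is a distributive algebraic lattice. The poset $\mathcal K(\mathcal C(\mathbf L))$ of compact elements of $\mathcal C(\mathbf L)$ consists of the principal convex subalgebras of $\mathbf L$ and is a sublattice of $\mathcal C(\mathbf L)$.
   Context: A residuated lattice is an algebra $\mathbf L=(L,\cdot,\backslash,/,\vee,\wedge,\mathrm e)$ such that $(L,\cdot,\mathrm e)$ is a monoid, $(L,\vee,\wedge)$ is a lattice with order $\le$, and $x\cdot y\le z \iff y\le x\backslash z \iff x\le z/y$ for all $x,y,z\in L$. It is $\mathrm e$-cyclic if $\mathrm e/x=x\backslash \mathrm e$ for all $x\in L$. A convex subalgebra of $\mathbf L$ is a subalgebra (closed under all operations, containing $\mathrm e$) whose universe is order-convex: $a\le x\le b$ with $a,b$ in it implies $x$ is in it. $\mathcal C(\mathbf L)$ is the set of convex subalgebras, ordered by inclusion. For $S\subseteq L$, $\mathrm C[S]$ is the smallest convex subalgebra containing $S$; $\mathrm C[a]=\mathrm C[\{a\}]$, and the convex subalgebras of the form $\mathrm C[a]$, $a\in L$, are called principal. *)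

(* Defs.v *)
From HB Require Import structures.
From mathcomp Require Import all_boot all_order.
From mathcomp Require Import boolp classical_sets cardinality.

Set Implicit Arguments.
Unset Strict Implicit.
Unset Printing Implicit Defensive.

Import Order.TTheory.
Local Open Scope classical_set_scope.
Local Open Scope order_scope.

(* [ldiv x z] is x \ z and [rdiv z y] is z / y.  The monoid is written with
   MathComp's group_scope notations; its unit e is [1%g]. *)
HB.mixin Record isResiduated (d : Order.disp_t) L
    of Order.Lattice d L & Monoid L := {
  ldiv : L -> L -> L;
  rdiv : L -> L -> L;
  le_ldiv : forall x y z : L, ((x * y)%g <= z) = (y <= ldiv x z);
  le_rdiv : forall x y z : L, ((x * y)%g <= z) = (x <= rdiv z y)
}.

#[short(type="residuatedLatticeType")]
HB.structure Definition ResiduatedLattice (d : Order.disp_t) :=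
  {L of isResiduated d L & Order.Lattice d L & Monoid L}.

Section ConvexSubalgebras.
Variables (d : Order.disp_t) (L : residuatedLatticeType d).

Definition e_cyclic := forall x : L, rdiv 1%g x = ldiv x 1%g.

Definition subalgebra (A : set L) :=
  A 1%g /\
  forall x y, A x -> A y ->
    [/\ A (x * y)%g, A (ldiv x y), A (rdiv x y), A (x `&` y)%O & A (x `|` y)%O].

Definition order_convex (A : set L) :=
  forall a b x, A a -> A b -> a <= x -> x <= b -> A x.

Definition convex_subalgebra (A : set L) := subalgebra A /\ order_convex A.

Record csub := CSub {
  carrier :> set L;
  _ : `[< convex_subalgebra carrier >]
}.

HB.instance Definition _ := [isSub for carrier].
HB.instance Definition _ := [Choice of csub by <:].
(* The order inherited from [set L] is inclusion. *)
HB.instance Definition _ := [SubChoice_isSubPOrder of csub by <: with set_display].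

Definition generated (S : set L) : set L := smallest convex_subalgebra S.

Definition principal (X : csub) := exists a : L, X = generated [set a] :> set L.

End ConvexSubalgebras.

Section PosetNotions.
Variables (d : Order.disp_t) (P : porderType d).

Definition distributive_lattice :=
  exists join meet : P -> P -> P,
    [/\ forall x y, supremums [set x; y] (join x y),
        forall x y, infimums [set x; y] (meet x y)
      & forall x y z, meet x (join y z) = join (meet x y) (meet x z)].

Definition complete_lattice :=
  forall S : set P, supremums S !=set0 /\ infimums S !=set0.

Definition compact_element (c : P) :=
  forall (S : set P) s, supremums S s -> c <= s ->
  exists F : set P, [/\ finite_set F, F `<=` S
    & exists2 t, supremums F t & c <= t].

Definition algebraic_lattice :=
  complete_lattice /\
  forall x : P, exists2 K : set P, K `<=` compact_element & supremums K x.

Definition sublattice (S : set P) :=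
  S !=set0 /\
  forall x y, S x -> S y ->
    (exists2 j, supremums [set x; y] j & S j) /\
    (exists2 m, infimums [set x; y] m & S m).

End PosetNotions.

Arguments e_cyclic {d} L.
Arguments csub {d} L.
Arguments distributive_lattice {d} P.
Arguments complete_lattice {d} P.
Arguments algebraic_lattice {d} P.

(* Main.v *)
(* Put |x| = x /\ x\e /\ e.  By e-cyclicity, if h <= |x| and h <= |y| then
   h * h <= |x o y| for every operation o, and a convex subalgebra contains x
   iff it contains |x|.  Since (p \/ u)(q \/ u) <= pq \/ u for negative p, q, u,
   the set {x : |x| \/ u in A} is a convex subalgebra whenever A is one and
   u <= e.  Taking u = |x| shows that x in C[S] forces x to lie in every convex
   subalgebra containing all |s| \/ |x| with s in S.  This gives both
   distributivity and C[a] /\ C[b] = C[|a| \/ |b|]; dually,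
   C[a] \/ C[b] = C[|a| /\ |b|].  Algebraicity holds because the elements
   generated by finitely many members of a family form a convex subalgebra. *)
Require Import Defs.
From mathcomp Require Import all_boot all_order.
From mathcomp Require Import boolp classical_sets.
From mathcomp Require Import cardinality.

Local Open Scope classical_set_scope.

Set Implicit Arguments.
Unset Strict Implicit.
Unset Printing Implicit Defensive.

Import Order.TTheory.

Section ResiduatedLattices.
Local Open Scope order_scope.
Variables (d : Order.disp_t) (L : residuatedLatticeType d).
Implicit Types (a b x y z u v h : L) (A S : set L).

(** * Order arithmetic of residuated lattices *)

Lemma ler_mulg x y z : y <= z -> (x * y <= x * z)%g.
Proof. by move=> le_yz; rewrite le_ldiv (le_trans le_yz)// -le_ldiv. Qed.

Lemma lel_mulg x y z : y <= z -> (y * x <= z * x)%g.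
Proof. by move=> le_yz; rewrite le_rdiv (le_trans le_yz)// -le_rdiv. Qed.

Lemma le_mulg x y z u : x <= y -> z <= u -> (x * z <= y * u)%g.
Proof. by move=> xy zu; rewrite (le_trans (lel_mulg _ xy)) ?ler_mulg. Qed.

Lemma mulg_le1l x y : y <= 1%g -> (x * y)%g <= x.
Proof. by move=> /(ler_mulg x); rewrite mulg1. Qed.

Lemma mulg_le1r x y : x <= 1%g -> (x * y)%g <= y.
Proof. by move=> /(lel_mulg y); rewrite mul1g. Qed.

Lemma mul_ldiv_le x y : (x * ldiv x y)%g <= y.
Proof. by rewrite le_ldiv. Qed.

Lemma mul_rdiv_le x y : (rdiv y x * x)%g <= y.
Proof. by rewrite le_rdiv. Qed.

(** By residuation the product distributes over joins; of the resulting terms [xy], [xu], [uy],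
    [uu], the last three lie below [u] because all factors are negative. *)
Lemma joinU_mulg_le u x y : u <= 1%g -> x <= 1%g -> y <= 1%g ->
  ((x `|` u) * (y `|` u))%g <= (x * y)%g `|` u.
Proof.
move=> u1 x1 y1; rewrite le_rdiv leUx -!le_rdiv; apply/andP; split.
  by rewrite le_ldiv leUx -!le_ldiv leUl (le_trans _ (leUr _ _))// mulg_le1r.
by rewrite (le_trans _ (leUr _ _))// mulg_le1l// leUx y1.
Qed.

(** * Absolute values and their role in convex subalgebras *)

Definition absv x := x `&` ldiv x 1%g `&` 1%g.

Lemma absv_le1 x : absv x <= 1%g. Proof. exact: leIr. Qed.

Lemma absv_le x : absv x <= x.
Proof. by rewrite /absv -meetA leIl. Qed.

Hypothesis Lcyc : e_cyclic L.

(** This is the form in which e-cyclicity enters the later arguments: [x <= e/y = y\e]. *)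
Lemma mulg_le1C x y : ((x * y)%g <= 1%g) = ((y * x)%g <= 1%g).
Proof. by rewrite le_rdiv Lcyc -le_ldiv. Qed.

(** Cyclicity turns [h <= x\e] into [h * x <= e], so lower bounds of |x| can be checked by
    products. *)
Lemma le_absvP h x : reflect [/\ h <= x, (h * x)%g <= 1%g & h <= 1%g] (h <= absv x).
Proof.
by rewrite mulg_le1C le_ldiv !lexI -andbA; exact: and3P.
Qed.

Lemma absvM_le1 x : (absv x * x)%g <= 1%g.
Proof. by have /le_absvP[] := lexx (absv x). Qed.

Lemma absv_id u : u <= 1%g -> absv u = u.
Proof.
move=> u1; apply/le_anti; rewrite absv_le/=; apply/le_absvP; split=> //.
by rewrite (le_trans (mulg_le1l _ u1)).
Qed.

(** Products and residuals use up one factor [h] for each operand, e.g. [hhxy <= hy <= e]; for meets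
    and joins [h * h <= h] is enough. *)
Lemma mulgg_le_absv_op h x y : h <= absv x -> h <= absv y ->
  [/\ (h * h)%g <= absv (x * y)%g, (h * h)%g <= absv (ldiv x y),
      (h * h)%g <= absv (rdiv x y), (h * h)%g <= absv (x `&` y)
    & (h * h)%g <= absv (x `|` y)].
Proof.
move=> /le_absvP[hx hx1 h1] /le_absvP[hy hy1 _].
have hhh : (h * h)%g <= h by exact: mulg_le1l.
have hh1 := le_trans hhh h1.
split; apply/le_absvP; split=> //.
- exact: le_mulg.
- by rewrite -mulgA (le_trans _ hy1)// ler_mulg// mulgA mulg_le1r.
- by rewrite -le_ldiv mulgA (le_trans _ hy)// mulg_le1r// mulg_le1C.
- rewrite -mulgA (le_trans _ hy1)// ler_mulg//.
  by rewrite (le_trans _ (mul_ldiv_le x y))// lel_mulg.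
- by rewrite -le_rdiv -mulgA (le_trans _ hx)// mulg_le1l.
(* Cyclic permutation moves [x/y] between the two factors [h], where
   [(x/y) * h <= (x/y) * y <= x]. *)
- rewrite mulg_le1C mulgA mulg_le1C (le_trans _ hx1)// ler_mulg//.
  by rewrite (le_trans _ (mul_rdiv_le y x))// ler_mulg.
- by rewrite (le_trans hhh)// lexI hx.
- by rewrite (le_trans _ hx1)// le_mulg// leIl.
- by rewrite (le_trans hhh)// (le_trans hx)// leUl.
- rewrite (le_trans (lel_mulg _ hhh))// le_ldiv leUx -!le_ldiv hx1.
  exact: hy1.
Qed.

(** |x| is a term in [x]; conversely [x] lies between |x| and [|x|\e], both in [A] once |x| is. *)
Lemma csub_absv A x : convex_subalgebra A -> A (absv x) <-> A x.
Proof.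
case=> -[A1 Aop] Acvx; split=> Ax; last first.
  have [_ Axe _ _ _] := Aop _ _ Ax A1.
  have [_ _ _ Axx _] := Aop _ _ Ax Axe.
  by have [] := Aop _ _ Axx A1.
have [_ Aup _ _ _] := Aop _ _ Ax A1.
by apply: (Acvx _ _ x Ax Aup (absv_le x)); rewrite -le_ldiv absvM_le1.
Qed.

Lemma csub_le1 A u v : convex_subalgebra A -> A u -> u <= v -> v <= 1%g -> A v.
Proof. by case=> -[A1 _] Acvx Au; apply: (Acvx _ _ v Au A1). Qed.

Lemma csub_le_absv A u x : convex_subalgebra A -> A u -> u <= absv x -> A x.
Proof.
move=> cA Au ux; apply/(csub_absv x cA).
exact: csub_le1 cA Au ux (absv_le1 x).
Qed.

(* With [h = |x| |y|], [|op x y| \/ u] lies between the element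
   [((|x| \/ u) (|y| \/ u)) ^ 2] of [A] and [e]. *)
Lemma csub_relative_polar A u : convex_subalgebra A -> u <= 1%g ->
  convex_subalgebra [set x | A (absv x `|` u)].
Proof.
move=> cA u1; have [[A1 Aop] _] := cA.
have neg h : h <= 1%g -> h `|` u <= 1%g by rewrite leUx u1 => ->.
have AM h k : h <= 1%g -> k <= 1%g ->
    A (h `|` u) -> A (k `|` u) -> A ((h * k)%g `|` u).
  move=> h1 k1 Ah Ak; have [Ahk _ _ _ _] := Aop _ _ Ah Ak.
  apply: (csub_le1 cA Ahk); first exact: joinU_mulg_le.
  by apply: neg; rewrite (le_trans (mulg_le1l _ k1)).
have mono h x : A (h `|` u) -> h <= absv x -> A (absv x `|` u).
  by move=> Ah hx; apply: (csub_le1 cA Ah); [exact: leU2|exact/neg/absv_le1].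
split; [split=> [|x y Ax Ay]|move=> a b x Aa Ab ax xb] => /=.
- by rewrite absv_id// (join_idPl u1).
- set h := (absv x * absv y)%g.
  have h1 : h <= 1%g by rewrite (le_trans (mulg_le1l _ (absv_le1 _))) ?absv_le1.
  have Ah : A (h `|` u) by apply: AM => //; exact: absv_le1.
  have Ahh : A ((h * h)%g `|` u) by exact: AM.
  have [||? ? ? ? ?] := @mulgg_le_absv_op h x y.
  + by rewrite mulg_le1l// absv_le1.
  + by rewrite mulg_le1r// absv_le1.
  + by split; apply: mono Ahh _.
(* |a| bounds [x] from below, and |b| keeps the product with [x] below e, since
   [|b| * x <= |b| * b <= e]. *)
- apply: (mono (absv a * absv b)%g).
    by apply: AM => //; exact: absv_le1.
  apply/le_absvP; split.
  + by rewrite (le_trans (mulg_le1l _ (absv_le1 _)))// (le_trans (absv_le _)).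
  + rewrite -mulgA (le_trans (mulg_le1r _ (absv_le1 _)))//.
    by rewrite (le_trans (ler_mulg _ xb))// absvM_le1.
  + by rewrite (le_trans (mulg_le1l _ (absv_le1 _)))// absv_le1.
Qed.

(** * Generated and principal convex subalgebras *)

Lemma csub_bigcap I (D : set I) (B : I -> set L) :
  (forall i, D i -> convex_subalgebra (B i)) ->
  convex_subalgebra (\bigcap_(i in D) B i).
Proof.
move=> cB; split; [split=> [|x y Bx By]|move=> a b x Ba Bb ax xb i Di].
- by move=> i /cB[[]].
- by split=> i Di; have [[_ Bop] _] := cB _ Di;
     have [] := Bop _ _ (Bx i Di) (By i Di).
- by have [_ Bcvx] := cB _ Di; exact: Bcvx (Ba i Di) (Bb i Di) ax xb.
Qed.

Lemma csub_generated S : convex_subalgebra (generated S).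
Proof. by apply: csub_bigcap => A []. Qed.

Lemma sub_generated S : S `<=` generated S.
Proof. by move=> x Sx A [_]; apply. Qed.

Lemma generated_sub S A :
  convex_subalgebra A -> S `<=` A -> generated S `<=` A.
Proof. by move=> cA SA x; apply. Qed.

Lemma generatedS S (T : set L) : S `<=` T -> generated S `<=` generated T.
Proof.
move=> ST; apply: generated_sub (csub_generated T) _.
exact: subset_trans ST (@sub_generated T).
Qed.

(** The relative polar for [u = |x|] contains [S], hence [x], and [|x| \/ u] collapses to |x|. *)
Lemma generated_absvU S A x : convex_subalgebra A -> generated S x ->
  (forall s, S s -> A (absv s `|` absv x)) -> A x.
Proof.
move=> cA Sx SA; apply/(csub_absv x cA); rewrite -[absv x]joinxx.
exact: (generated_sub (csub_relative_polar cA (absv_le1 x)) SA Sx).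
Qed.

Lemma generated1_sub A a : convex_subalgebra A -> A a ->
  generated [set a] `<=` A.
Proof. by move=> cA Aa; apply: generated_sub => // x ->. Qed.

Lemma mem_generated1 a : generated [set a] a.
Proof. exact: sub_generated. Qed.
Arguments mem_generated1 : clear implicits.

Lemma generatedI a b :
  (generated [set a] `&` generated [set b])%classic = generated [set absv a `|` absv b].
Proof.
set c := absv a `|` absv b.
have c1 : c <= 1%g by rewrite leUx !absv_le1.
have cC := csub_generated [set c].
have sub e : absv e <= c -> generated [set c] `<=` generated [set e].
  move=> ec; have cE := csub_generated [set e].
  have Ee : generated [set e] (absv e).
    by apply/(csub_absv _ cE); exact: mem_generated1.
  exact: (generated1_sub cE (csub_le1 cE Ee ec c1)).
rewrite eqEsubset; split=> [x [ax bx]|]; last first.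
  by rewrite subsetI; split; apply: sub; rewrite ?leUl ?leUr.
apply: (generated_absvU cC bx) => _ ->.
(* The criterion is used twice: once for [b], reducing the goal to [y], then for [a], since [y] lies
   in C[a] between |x| and e. What remains is [|a| \/ |b| \/ |x|], between [c] and e. *)
set y := absv b `|` absv x.
have y1 : y <= 1%g by rewrite leUx !absv_le1.
have cA := csub_generated [set a].
have ay : generated [set a] y.
  apply: (csub_le1 cA _ _ y1); last exact: leUr.
  by apply/(csub_absv _ cA).
apply: (generated_absvU cC ay) => _ ->; rewrite (absv_id y1).
have cy : c <= absv a `|` y by rewrite joinA leUl.
have ay1 : absv a `|` y <= 1%g by rewrite leUx absv_le1.
exact: (csub_le1 cC (mem_generated1 c) cy ay1).
Qed.

(** [c] lies below |a| and |b|, so C[c] contains [a] and [b]; conversely [c] is a meet of two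
    elements of the join. *)
Lemma generatedU a b :
  generated (generated [set a] `|` generated [set b])%classic =
  generated [set absv a `&` absv b].
Proof.
set c := absv a `&` absv b.
have c1 : c <= 1%g by rewrite (le_trans (leIl _ _))// absv_le1.
have cC := csub_generated [set c].
have Cc := mem_generated1 c.
rewrite eqEsubset; split.
  apply: generated_sub => //; rewrite subUset; split; apply: generated1_sub => //.
    by apply: csub_le_absv cC Cc _; rewrite leIl.
  by apply: csub_le_absv cC Cc _; rewrite leIr.
set U := generated (_ `|` _)%classic.
have cU : convex_subalgebra U by exact: csub_generated.
have [[_ Uop] _] := cU.
apply: generated1_sub => //.
have Ua : U (absv a).
  by apply/(csub_absv _ cU); apply: sub_generated; left; exact: mem_generated1.
have Ub : U (absv b).
  by apply/(csub_absv _ cU); apply: sub_generated; right; exact: mem_generated1.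
by have [] := Uop _ _ Ua Ub.
Qed.

(** The elements generated by finite subfamilies form a convex subalgebra because two finite index
    sets can be merged into their union. *)
Lemma generated_bigcup_finite I (D : set I) (B : I -> set L) x :
  generated (\bigcup_(i in D) B i) x ->
  exists E : set I, [/\ finite_set E, E `<=` D
    & generated (\bigcup_(i in E) B i) x].
Proof.
pose G : set L := [set x | exists E : set I, [/\ finite_set E, E `<=` D
  & generated (\bigcup_(i in E) B i) x]].
have dir y z : G y -> G z -> exists E : set I, [/\ finite_set E, E `<=` D,
   generated (\bigcup_(i in E) B i) y & generated (\bigcup_(i in E) B i) z].
  move=> [E1 [fin1 sub1 gen1]] [E2 [fin2 sub2 gen2]].
  exists (E1 `|` E2)%classic; split.
  - by rewrite finite_setU.
  - by rewrite subUset.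
  - by apply: generatedS gen1; apply: bigcup_subset => i ?; left.
  - by apply: generatedS gen2; apply: bigcup_subset => i ?; right.
suff cG : convex_subalgebra G.
  move: x; apply: generated_sub => // x [i Di Bx].
  exists [set i]; split; [exact: finite_set1|by move=> _ ->|].
  by apply: sub_generated; exists i.
split; [split=> [|y z Gy Gz]|move=> a b y Ga Gb ay yb].
- exists set0; split=> //.
  by have [[]] := csub_generated (\bigcup_(i in set0) B i).
- have [E [finE ED Ey Ez]] := dir _ _ Gy Gz.
  have [[_ Eop] _] := csub_generated (\bigcup_(i in E) B i).
  by have [] := Eop _ _ Ey Ez; split; exists E.
- have [E [finE ED Ea Eb]] := dir _ _ Ga Gb.
  exists E; split=> //.
  have [_ Ecvx] := csub_generated (\bigcup_(i in E) B i).
  exact: Ecvx Ea Eb ay yb.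
Qed.

End ResiduatedLattices.

(** * The lattice of convex subalgebras and its compact elements *)

Section CsubPoset.
Local Open Scope order_scope.
Local Open Scope classical_set_scope.
Variables (d : Order.disp_t) (L : residuatedLatticeType d).
Implicit Types (X Y Z : csub L) (S : set (csub L)) (A : set L) (a : L).

Lemma csubP X : convex_subalgebra X.
Proof. by case: X => A /= /asboolP. Qed.

Definition mkcsub A (cA : convex_subalgebra A) : csub L := CSub (asboolT cA).

Lemma csub_leE X Y : (X <= Y) = (X `<=` Y) :> Prop.
Proof. by rewrite -subsetEset. Qed.

Lemma csub_inj X Y : X = Y :> set L -> X = Y.
Proof. by move=> XY; exact: val_inj. Qed.

Definition csub_gen A : csub L := mkcsub (csub_generated A).

Definition csup S : csub L := csub_gen (\bigcup_(X in S) X).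

Lemma csup_supremum S : supremums S (csup S).
Proof.
split=> [X SX|Y SY]; rewrite csub_leE.
  by move=> x Xx; apply: sub_generated; exists X.
apply: (generated_sub (csubP Y)) => x [X SX].
by have := SY X SX; rewrite csub_leE; apply.
Qed.

(** For empty [S] the intersection is all of [L], the top element. *)
Definition cinf S : csub L :=
  mkcsub (@csub_bigcap _ _ _ S (@carrier d L) (fun X _ => csubP X)).

Lemma cinf_infimum S : infimums S (cinf S).
Proof.
split=> [X SX|Y YS]; rewrite csub_leE => x; first exact.
by move=> Yx X SX; have := YS X SX; rewrite csub_leE; apply.
Qed.

Definition cjoin X Y : csub L := csub_gen (X `|` Y).

Lemma csub_setI X Y : convex_subalgebra (X `&` Y).
Proof.
have -> : X `&` Y = \bigcap_(Z in [set X; Y]) Z by rewrite bigcap_setU !bigcap_set1.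
by apply: csub_bigcap => Z _; exact: csubP.
Qed.

Definition cmeet X Y : csub L := mkcsub (csub_setI X Y).

Lemma cjoin_supremum X Y : supremums [set X; Y] (cjoin X Y).
Proof.
split=> [_ [|] ->|Z ZXY]; rewrite csub_leE.
- by move=> x Xx; apply: sub_generated; left.
- by move=> x Yx; apply: sub_generated; right.
- apply: (generated_sub (csubP Z)); rewrite subUset.
  by rewrite -!csub_leE; split; apply: ZXY; [left|right].
Qed.

Lemma cmeet_infimum X Y : infimums [set X; Y] (cmeet X Y).
Proof.
split=> [_ [|] ->|Z ZXY]; rewrite csub_leE.
- by move=> x [].
- by move=> x [].
- change (Z `<=` X `&` Y); rewrite subsetI.
  by rewrite -!csub_leE; split; apply: ZXY; [left|right].
Qed.

Definition cprinc a : csub L := csub_gen [set a].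

Lemma cprinc_le a X : (cprinc a <= X) = (X : set L) a :> Prop.
Proof.
rewrite csub_leE; apply/propext; split=> [|Xa]; first by apply; exact: mem_generated1.
exact: generated1_sub (csubP X) Xa.
Qed.

Lemma cprinc_supremum X : supremums [set cprinc a | a in X] X.
Proof.
split=> [_ [a Xa <-]|Y XY]; first by rewrite cprinc_le.
by rewrite csub_leE => a Xa; rewrite -[(Y : set L) a]cprinc_le; apply: XY; exists a.
Qed.

(** Lying above [cprinc a] only means containing [a], and membership of [a] in a join involves
    finitely many members. *)
Lemma compact_cprinc a : compact_element (cprinc a).
Proof.
move=> S X SX aX.
have : cprinc a <= csup S.
  by rewrite (le_trans aX)//; apply: SX.2; case: (csup_supremum S).
rewrite cprinc_le => /generated_bigcup_finite[F [finF FS Fa]].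
exists F; split=> //; exists (csup F); first exact: csup_supremum.
by rewrite cprinc_le.
Qed.

Hypothesis Lcyc : e_cyclic L.

Lemma cmeet_cjoinr X Y Z : cmeet X (cjoin Y Z) = cjoin (cmeet X Y) (cmeet X Z).
Proof.
apply: csub_inj; set T := cjoin (cmeet X Y) (cmeet X Z).
rewrite eqEsubset; split=> [x [Xx YZx]|]; last first.
  apply: (generated_sub (csubP _)); rewrite subUset.
  by split=> x [Xx ?]; split=> //; apply: sub_generated; [left|right].
have cX := csubP X.
(* [|s| \/ |x|] lies between |x| and e, hence in [X], and between |s| and e, hence in [W]. *)
have U (W : csub L) s : (W : set L) s -> (cmeet X W : set L) (absv s `|` absv x)%O.
  move=> Ws; have s1 : (absv s `|` absv x)%O <= 1%g by rewrite leUx !absv_le1.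
  have cW := csubP W.
  have /(csub_absv Lcyc _ cX) Xx' := Xx.
  have /(csub_absv Lcyc _ cW) Ws' := Ws.
  split; first exact: csub_le1 cX Xx' (leUr _ _) s1.
  exact: csub_le1 cW Ws' (leUl _ _) s1.
apply: (generated_absvU Lcyc (csubP T) YZx) => s [] /U; move=> ?; apply: sub_generated.
  by left.
by right.
Qed.

(** [X] is the join of the C[a] with [a] in [X]; compactness leaves finitely many, which are then
    absorbed into one. *)
Lemma compact_principal X : compact_element X -> principal X.
Proof.
move=> /(_ _ _ (cprinc_supremum X) (lexx X))[F [/finite_seqP[s ->]] sX [Y sY XY]].
suff [a Xa sa] : exists2 a, (X : set L) a & forall Z, Z \in s -> Z <= cprinc a.
  exists a; rewrite -[generated _]/(cprinc a : set L); congr carrier.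
  apply/le_anti/andP; split; last by rewrite cprinc_le.
  by rewrite (le_trans XY)//; apply: sY.2 => Z /sa.
elim: s sX {Y sY XY} => [_|Z s IHs sX].
  by exists 1%g => //; have [[]] := csubP X.
have [|a Xa sa] := IHs; first by move=> W sW; apply: sX; rewrite /= inE sW orbT.
have [b Xb <-] : [set cprinc a | a in X] Z by apply: sX; rewrite /= inE eqxx.
have cX := csubP X.
have [[_ Xop] _] := cX.
(* The meet of absolute values stays in [X] and generates both [a] and [b]. *)
exists (absv a `&` absv b)%O.
  have /(csub_absv Lcyc _ cX) Xa' := Xa.
  have /(csub_absv Lcyc _ cX) Xb' := Xb.
  by have [] := Xop _ _ Xa' Xb'.
have le e : (absv a `&` absv b)%O <= absv e -> cprinc e <= cprinc (absv a `&` absv b)%O.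
  move=> ce; rewrite cprinc_le.
  by apply: (csub_le_absv Lcyc (csub_generated _) _ ce); exact: mem_generated1.
move=> W; rewrite inE => /predU1P[->|/sa Wa]; first by rewrite le// leIr.
by rewrite (le_trans Wa)// le// leIl.
Qed.

Lemma compactP X : compact_element X <-> principal X.
Proof.
split=> [|[a Xa]]; first exact: compact_principal.
have -> : X = cprinc a by exact: csub_inj.
exact: compact_cprinc.
Qed.

End CsubPoset.

Theorem theorem3p8 (d : Order.disp_t) (L : residuatedLatticeType d) :
  e_cyclic L ->
  [/\ distributive_lattice (csub L),
      algebraic_lattice (csub L),
      (forall X : csub L, compact_element X <-> principal X)
    & sublattice [set X : csub L | compact_element X]].
Proof.
move=> Lcyc; split.
- exists (@cjoin d L), (@cmeet d L); split.
  + exact: cjoin_supremum.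
  + exact: cmeet_infimum.
  + exact: cmeet_cjoinr.
- split=> [S|X].
    by split; [exists (csup S); exact: csup_supremum|exists (cinf S); exact: cinf_infimum].
  exists [set cprinc a | a in X]; last exact: cprinc_supremum.
  by move=> _ [a _ <-]; exact: compact_cprinc.
- exact: compactP.
- split=> [|X Y /(compactP Lcyc)[a Xa] /(compactP Lcyc)[b Yb]].
    by exists (cprinc 1%g); exact: compact_cprinc.
  (* The generators of the join and the meet come from [generatedU] and [generatedI]. *)
  split.
    exists (cjoin X Y); first exact: cjoin_supremum.
    apply/(compactP Lcyc); exists (absv a `&` absv b)%O.
    by rewrite -generatedU// -Xa -Yb.
  exists (cmeet X Y); first exact: cmeet_infimum.
  apply/(compactP Lcyc); exists (absv a `|` absv b)%O.
  by rewrite -generatedI// -Xa -Yb.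
Qed.
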